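(* Let $N\ge 1$ be an integer, and let $\alpha<1$ and $c>0$ be real. Let $a_n$ and $b_n$ be the recurrence coefficients of the orthonormal polynomials for the weight $$w(x)=\binom{N}{x}\frac{c^x}{(1-\alpha)_x},\qquad x\in\{0,1,\ldots,N\},$$ with the conventions $a_0^2=0=a_{N+1}^2$. Define $$x_n=\frac1N\left(\frac{a_n^2}{c}+n\right)\quad(0\le n\le N+1),\qquad y_n=-\frac{b_n+N+1+c-n-\alpha}{N}\quad(0\le n\le N).$$ Then $x_n,y_n$ satisfy the discrete system $$(x_n+y_n)(x_{n+1}+y_n)=-\frac{y_n\,(N+1+Ny_n)\,(N+1-\alpha+Ny_n)}{cN}\qquad(0\le n\le N),$$ $$(x_n+y_n)(x_n+y_{n-1})=\frac{x_n\,(-N-1+Nx_n)\,(\alpha-N-1+Nx_n)}{N\,(Nx_n-n)}\qquad(1\le n\le N),$$ with initial conditions $$x_0=0,\qquad y_0=-\frac{N+1+c-\alpha}{N}-\frac{c}{1-\alpha}\,\frac{M(-N+1,2-\alpha,-c)}{M(-N,1-\alpha,-c)},$$ where $M(a,b,z)$ is the confluent hypergeometric function ${}_1F_1(a;b;z)$.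
   Context: The Pochhammer symbol is $(a)_n=\prod_{j=0}^{n-1}(a+j)$, with $(a)_0=1$. The confluent hypergeometric function is $M(a,b,z)={}_1F_1(a;b;z)=\sum_{s=0}^\infty \frac{(a)_s}{(b)_s\,s!}z^s$ (a finite sum when $a$ is a non-positive integer). Orthonormal polynomials for the weight $w$ on $\{0,1,\ldots,N\}$: real polynomials $p_0,\ldots,p_N$ with $\deg p_n=n$ and positive leading coefficient such that $\sum_{k=0}^N p_m(k)p_n(k)w(k)=\delta_{m,n}$ for $0\le m,n\le N$. The recurrence coefficients are $a_n=\sum_{k=0}^N k\,p_n(k)p_{n-1}(k)w(k)$ for $1\le n\le N$ and $b_n=\sum_{k=0}^N k\,p_n(k)^2w(k)$ for $0\le n\le N$. They appear in the three-term recurrence $xp_n(x)=a_{n+1}p_{n+1}(x)+b_np_n(x)+a_np_{n-1}(x)$ for $0\le n\le N-1$, with $p_{-1}=0$. By convention $a_0=0$ and $a_{N+1}=0$. *)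

(* Defs.v *)
From HB Require Import structures.
From mathcomp Require Import all_boot all_order all_algebra.
From mathcomp Require Import reals topology normedtype sequences.

Set Implicit Arguments.
Unset Strict Implicit.
Unset Printing Implicit Defensive.

Import Order.TTheory GRing.Theory Num.Theory.
Import numFieldNormedType.Exports.

Local Open Scope ring_scope.

Definition pochhammer (R : realType) (a : R) (n : nat) : R :=
  \prod_(j < n) (a + j%:R).

(* Confluent hypergeometric function 1F1(a; b; z).  When a is a non-positive
   integer all terms with s > - a vanish, so the series is a finite sum. *)
Definition hyp1F1 (R : realType) (a b z : R) : R :=
  limn (series (fun s : nat =>
    pochhammer a s / (pochhammer b s * (s`!)%:R) * z ^+ s)).

Definition weight (R : realType) (N : nat) (alpha c : R) (x : nat) : R :=
  'C(N, x)%:R * (c ^+ x / pochhammer (1 - alpha) x).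

(* Only p 0, ..., p N are constrained; size p = n.+1 means deg p = n. *)
Definition orthonormal_polys (R : realType) (N : nat) (w : nat -> R)
    (p : nat -> {poly R}) : Prop :=
  [/\ forall n, (n <= N)%N -> size (p n) = n.+1,
      forall n, (n <= N)%N -> 0 < lead_coef (p n)
    & forall m n, (m <= N)%N -> (n <= N)%N ->
        \sum_(k < N.+1) (p m).[k%:R] * (p n).[k%:R] * w k = (m == n)%:R].

(* The conventions a_0 = 0 and a_{N+1} = 0 are built in. *)
Definition rec_a (R : realType) (N : nat) (w : nat -> R) (p : nat -> {poly R})
    (n : nat) : R :=
  if (0 < n <= N)%N
  then \sum_(k < N.+1) k%:R * (p n).[k%:R] * (p n.-1).[k%:R] * w k
  else 0.

Definition rec_b (R : realType) (N : nat) (w : nat -> R) (p : nat -> {poly R})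
    (n : nat) : R :=
  \sum_(k < N.+1) k%:R * (p n).[k%:R] ^+ 2 * w k.

(* Main.v *)
(* The Pearson equation k (k - alpha) w(k) = c (N - k + 1) w(k - 1) says that, on
   functions on {0, ..., N}, the operator A = c (N - x) S with S f(x) = f(x + 1)
   has adjoint x (x - alpha) S^-1.  Computing A p_n from above and the adjoint
   from below, by degrees, gives all entries of A in the basis (p_n) in terms of
   a_n and b_n; the commutation relation A x = (x + 1) A, written with the
   three-term recurrence, then gives two Laguerre-Freud equations.  Equivalently,
   A acts on (p_n, p_(n-1)) by a 2x2 matrix, polynomial in x, whose determinant
   does not depend on n and equals c (N - x) (x + 1) (x + 1 - alpha).  The zeros
   in xi = x - N of its entries are N y_n, N y_(n-1) and - N x_n, and evaluating
   the determinant there gives the two equations of the system. *)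

Require Import Defs.
From HB Require Import structures.
From mathcomp Require Import all_boot all_order all_algebra.
From mathcomp Require Import reals topology normedtype sequences.
From mathcomp Require Import ring zify.

Set Implicit Arguments.
Unset Strict Implicit.
Unset Printing Implicit Defensive.

Import Order.TTheory GRing.Theory Num.Theory.
Import numFieldNormedType.Exports.

Local Open Scope ring_scope.

(** Horner induction: with D the difference for step h, D(q X + a) = (D q) X + h D q + h q, and only
    the first and last terms reach degree n - 1. For n = 0 the truncated index [n.-1] is harmless,
    as both sides vanish. *)
Lemma poly_shift_size_coef (R : comNzRingType) (h : R) (q : {poly R}) (n : nat) :
  (size q <= n.+1)%N ->
  (size (q \Po ('X + h%:P) - q)%R <= n)%N /\
  (q \Po ('X + h%:P) - q)`_n.-1 = h * n%:R * q`_n.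
Proof.
elim/poly_ind: q n => [|q a IH] n sq.
  by rewrite comp_poly0 subr0 size_poly0 !coef0 mulr0.
have sq' : (size q <= n)%N.
  have [->|q0] := eqVneq q 0; first by rewrite size_poly0.
  by move: sq; rewrite size_MXaddC (negPf q0).
rewrite comp_poly_MXaddC.
have -> : (q \Po ('X + h%:P)) * ('X + h%:P) + a%:P - (q * 'X + a%:P) =
    (q \Po ('X + h%:P) - q) * 'X + h *: (q \Po ('X + h%:P) - q) + h *: q.
  by rewrite -!mul_polyC; ring.
case: n => [|n] in sq sq' *.
  move: sq'; rewrite leqn0 size_poly_eq0 => /eqP q0.
  by rewrite q0 comp_poly0 subr0 mul0r !scaler0 !addr0 size_poly0 coef0 mulr0 mul0r.
have [s1 c1] := IH n sq'; set e := _ - q in s1 c1 *; split.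
  apply/leq_sizeP => j nj; rewrite !coefD coefMX !coefZ.
  rewrite (nth_default 0 (leq_trans s1 (ltnW nj))) (nth_default 0 (leq_trans sq' nj)).
  have -> : j == 0%N = false by lia.
  have -> : e`_j.-1 = 0 by apply: nth_default; apply: leq_trans s1 _; lia.
  by rewrite !mulr0 !addr0.
rewrite /= !coefD coefMX !coefZ coefC coefMX c1 (nth_default 0 s1) mulr0 addr0 addr0 /=.
case: n {IH} => [|n] /= in s1 c1 sq sq' *; first by rewrite add0r mulr1.
by rewrite [n.+2%:R]mulrS; ring.
Qed.

(** * Orthonormal polynomials on a finite grid *)

Section DiscreteFunctional.

Context (R : realType) (N : nat) (w : nat -> R).

Definition dsum (f : {poly R}) : R := \sum_(k < N.+1) f.[k%:R] * w k.

Lemma dsumD f g : dsum (f + g) = dsum f + dsum g.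
Proof.
by rewrite /dsum -big_split; apply: eq_bigr => k _; rewrite hornerD mulrDl.
Qed.

Lemma dsumZ a f : dsum (a *: f) = a * dsum f.
Proof. by rewrite /dsum big_distrr; apply: eq_bigr => k _; rewrite hornerZ -mulrA. Qed.

Lemma dsumB f g : dsum (f - g) = dsum f - dsum g.
Proof. by rewrite dsumD -scaleN1r dsumZ mulN1r. Qed.

Lemma eq_dsum f g : (forall k, (k <= N)%N -> f.[k%:R] = g.[k%:R]) -> dsum f = dsum g.
Proof. by move=> fg; apply: eq_bigr => k _; rewrite fg // -ltnS. Qed.

Context (p : nat -> {poly R}).
Hypothesis hp : orthonormal_polys N w p.

Let a := rec_a N w p.
Let b := rec_b N w p.

Lemma dsum_pp m n : (m <= N)%N -> (n <= N)%N -> dsum (p m * p n) = (m == n)%:R.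
Proof.
case: hp => _ _ o mN nN; rewrite -o //; apply: eq_bigr => k _.
by rewrite hornerM.
Qed.

Lemma lead_gt0 n : (n <= N)%N -> 0 < (p n)`_n.
Proof. by case: hp => s l _ nN; have := l n nN; rewrite lead_coefE s. Qed.

Lemma dsum_p_lower n (q : {poly R}) : (n <= N)%N -> (size q <= n)%N -> dsum (p n * q) = 0.
Proof.
(* Strong induction on the size of [q]: its leading term is removed with a multiple of some [p m], m
   < n. *)
move=> nN; elim: {q}_.+1 {-2}q (ltnSn (size q)) => // s IH q sq qn.
have [q0|q0] := eqVneq q 0.
  by rewrite q0 mulr0; apply: big1 => k _; rewrite horner0 mul0r.
have [m mE] : exists m, size q = m.+1.
  by exists (size q).-1; rewrite prednK // size_poly_gt0.
have mN : (m <= N)%N by lia.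
have lm := lead_gt0 mN.
have -> : q = (q - (q`_m / (p m)`_m) *: p m) + (q`_m / (p m)`_m) *: p m.
  by rewrite subrK.
have hs : (size (q - (q`_m / (p m)`_m) *: p m)%R <= m)%N.
  apply/leq_sizeP => j mj; rewrite coefB coefZ.
  have [<-|nmj] := eqVneq m j; first by rewrite divfK ?subrr // gt_eqF.
  have mj' : (m < j)%N by lia.
  have [hs _ _] := hp.
  have -> : q`_j = 0 by rewrite nth_default ?mE.
  by rewrite (_ : (p m)`_j = 0) ?mulr0 ?subr0 // nth_default // hs.
rewrite mulrDr dsumD IH ?add0r.
- rewrite -scalerAr dsumZ dsum_pp //.
  have -> : n == m = false by lia.
  by rewrite mulr0.
- by apply: leq_ltn_trans hs _; lia.
- by apply: leq_trans hs _; lia.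
Qed.

(** Subtracting the right multiple of [p n] leaves a polynomial of lower degree, orthogonal to
    [p n]. This reads operator entries off leading coefficients. *)
Lemma dsum_p_coef n (q : {poly R}) : (n <= N)%N -> (size q <= n.+1)%N ->
  dsum (p n * q) = q`_n / (p n)`_n.
Proof.
move=> nN sq; have ln := lead_gt0 nN; case: hp => hs _ _.
have -> : q = (q - (q`_n / (p n)`_n) *: p n) + (q`_n / (p n)`_n) *: p n.
  by rewrite subrK.
rewrite mulrDr dsumD dsum_p_lower ?add0r //; last first.
  apply/leq_sizeP => j mj; rewrite coefB coefZ.
  have [<-|nmj] := eqVneq n j; first by rewrite divfK ?subrr // gt_eqF.
  have mj' : (n < j)%N by lia.
  have -> : q`_j = 0 by rewrite nth_default // (leq_trans sq).
  by rewrite (_ : (p n)`_j = 0) ?mulr0 ?subr0 // nth_default // hs.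
rewrite -scalerAr dsumZ dsum_pp // eqxx mulr1.
by rewrite coefD coefB coefZ subrK.
Qed.

Lemma rec_bE n : b n = dsum (p n * ('X * p n)).
Proof. by apply: eq_bigr => k _; rewrite !hornerM hornerX; ring. Qed.

Lemma rec_aE n : (n < N)%N -> a n.+1 = dsum (p n.+1 * ('X * p n)).
Proof.
by move=> nN; rewrite /a /rec_a nN /=; apply: eq_bigr => k _;
  rewrite !hornerM hornerX; ring.
Qed.

Lemma rec_a_ratio n : (n < N)%N -> a n.+1 = (p n)`_n / (p n.+1)`_n.+1.
Proof.
move=> nN; have [hs _ _] := hp.
rewrite rec_aE // dsum_p_coef //; first by rewrite coefXM.
by rewrite -commr_polyX size_mulX ?hs ?(ltnW nN) // -size_poly_eq0 hs ?(ltnW nN).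
Qed.

Lemma rec_a_gt0 n : (n < N)%N -> 0 < a n.+1.
Proof. by move=> nN; rewrite rec_a_ratio // divr_gt0 // lead_gt0 // ltnW. Qed.

Lemma rec_a_0 : a 0 = 0. Proof. by []. Qed.

Lemma rec_a_top : a N.+1 = 0. Proof. by rewrite /a /rec_a ltnn. Qed.

(* Orthonormality says [P (W P^T) = 1] for the square matrix [P] of values,
   hence [(W P^T) P = 1]: a function orthogonal to all [p m] vanishes. *)
Lemma p_complete (d : nat -> R) :
  (forall m, (m <= N)%N -> \sum_(k < N.+1) d k * (p m).[k%:R] * w k = 0) ->
  forall l, (l <= N)%N -> d l = 0.
Proof.
move=> hd l lN.
pose P := \matrix_(i < N.+1, k < N.+1) (p i).[k%:R].
pose Q := \matrix_(k < N.+1, i < N.+1) (w k * (p i).[k%:R]).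
have PQ : P *m Q = 1%:M.
  apply/matrixP => i j; rewrite !mxE -(val_eqE i j) -(dsum_pp (leq_ord i) (leq_ord j)).
  by apply: eq_bigr => k _; rewrite !mxE hornerM; ring.
have /matrixP QP := mulmx1C PQ.
have -> : d l = \sum_(k < N.+1) d k * (k == inord l)%:R.
  rewrite (bigD1 (inord l)) //= eqxx mulr1 inordK // big1 ?addr0 // => k.
  by move/negPf->; rewrite mulr0.
under eq_bigr => k _.
  have := QP k (inord l); rewrite !mxE => <-; rewrite big_distrr /=.
over.
rewrite exchange_big big1 //= => m _.
transitivity ((\sum_(k < N.+1) d k * (p m).[k%:R] * w k) * (p m).[l%:R]).
  by rewrite big_distrl; apply: eq_bigr => k _; rewrite !mxE inordK //=; ring.
by rewrite hd ?mul0r // -ltnS.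
Qed.

(** Stated for values on the grid, so that n = N is included: there a_(N+1) = 0 removes the
    unconstrained [p N.+1]. By [p_complete] it suffices to pair both sides with each [p m];
    multiplication by X is symmetric, so X can be moved onto the factor of lower degree. *)
Lemma three_term n k : (n <= N)%N -> (k <= N)%N ->
  k%:R * (p n).[k%:R] =
  a n.+1 * (p n.+1).[k%:R] + b n * (p n).[k%:R] + a n * (p n.-1).[k%:R].
Proof.
move=> nN kN; have [hs _ _] := hp.
have size_Xp m : (m <= N)%N -> size ('X * p m) = m.+2.
  by move=> mN; rewrite -commr_polyX size_mulX -?size_poly_eq0 hs.
pose q := 'X * p n - (a n.+1 *: p n.+1 + b n *: p n + a n *: p n.-1).
suff : q.[k%:R] = 0.
  by move/eqP; rewrite !hornerE subr_eq0 => /eqP.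
apply: (@p_complete (fun k => q.[k%:R])) => // m mN.
transitivity (dsum (p m * q)).
  by apply: eq_bigr => i _; rewrite hornerM; ring.
rewrite mulrBr !mulrDr dsumB !dsumD -!scalerAr !dsumZ.
have -> : a n.+1 * dsum (p m * p n.+1) = a n.+1 * (m == n.+1)%:R.
  have [nN'|] := ltnP n N; first by rewrite dsum_pp.
  by move=> h; have -> : n = N by [lia]; rewrite rec_a_top !mul0r.
have -> : a n * dsum (p m * p n.-1) = a n * (m.+1 == n)%:R.
  case: n nN {q} => [|n] nN; first by rewrite rec_a_0 !mul0r.
  by rewrite dsum_pp // ltnW.
rewrite (dsum_pp mN nN).
have [mn|mn|mn] := ltngtP m n.
- rewrite (_ : dsum _ = dsum (p n * ('X * p m))); last by congr dsum; ring.
  have -> : m == n.+1 = false by lia.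
  rewrite !mulr0 !add0r.
  have [mn'|mn'] := eqVneq m.+1 n.
    by rewrite -mn' rec_aE ?mulr1 ?subrr //; lia.
  by rewrite dsum_p_lower ?mulr0 ?subrr // size_Xp //; lia.
- have -> : m.+1 == n = false by lia.
  rewrite !mulr0 !addr0.
  have [mn'|mn'] := eqVneq m n.+1.
    by rewrite mn' rec_aE ?mulr1 ?subrr //; lia.
  by rewrite dsum_p_lower ?mulr0 ?subrr // size_Xp //; lia.
- rewrite mn rec_bE.
  have -> : n == n.+1 = false by lia.
  have -> : n.+1 == n = false by lia.
  by rewrite !mulr0 mulr1 addr0 add0r subrr.
Qed.

End DiscreteFunctional.

(** * Pearson equation, shift operator and Laguerre-Freud equations *)

Section GeneralizedKrawtchouk.

Context (R : realType) (N : nat) (alpha c : R).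
Hypothesis halpha : alpha < 1.

Lemma pochhammerS (t : R) n : pochhammer t n.+1 = pochhammer t n * (t + n%:R).
Proof. by rewrite /pochhammer big_ord_recr. Qed.

Lemma pochhammerS_l (t : R) n : pochhammer t n.+1 = t * pochhammer (t + 1) n.
Proof.
rewrite /pochhammer big_ord_recl; congr (_ * _); first exact: addr0.
by apply: eq_bigr => i _; rewrite /= /bump /= add1n mulrS addrA.
Qed.

Lemma pochhammer_gt0 (t : R) n : 0 < t -> 0 < pochhammer t n.
Proof. by move=> t0; apply: prodr_gt0 => i _; rewrite ltr_wpDr. Qed.

Let w := weight N alpha c.

Lemma weight_pearson k : (k <= N)%N ->
  w k.+1 * (k.+1%:R * (k.+1%:R - alpha)) = w k * (c * (N%:R - k%:R)).
Proof.
move=> kN; have a1 : 0 < 1 - alpha by rewrite subr_gt0.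
have p0 : pochhammer (1 - alpha) k != 0 by rewrite gt_eqF // pochhammer_gt0.
have q0 : 1 - alpha + k%:R != 0 by rewrite gt_eqF // ltr_wpDr.
have hbin := congr1 (fun i : nat => i%:R : R) (mul_bin_left N k).
rewrite /= !natrM natrB // in hbin.
rewrite /w /weight pochhammerS exprS.
transitivity (k.+1%:R * 'C(N, k.+1)%:R * (c * (c ^+ k / pochhammer (1 - alpha) k))).
  by rewrite -[k.+1]addn1 natrD in q0 *; field; rewrite p0 q0.
by rewrite hbin; ring.
Qed.

Let tau : {poly R} := c *: (N%:R%:P - 'X).
Let sigma : {poly R} := 'X * ('X - alpha%:P).

(** Summation by parts without boundary terms: [tau] vanishes at N and [sigma] at 0, so the index
    shift matches the remaining terms through the Pearson equation. *)
Lemma dsum_pearson (g : {poly R}) :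
  dsum N w (tau * g) = dsum N w (sigma * (g \Po ('X + (-1)%:P))).
Proof.
have wp k : (k < N)%N -> _ := fun kN => @weight_pearson k (ltnW kN).
move: (w) wp => v wp; rewrite /dsum big_ord_recr [RHS]big_ord_recl /=.
have -> : (tau * g).[N%:R] = 0 by rewrite !hornerE subrr mulr0 mul0r.
have s0 : sigma.[0] = 0 by rewrite !hornerE.
rewrite [(sigma * _).[_]]hornerM (_ : sigma.[_] = 0); last exact: s0.
rewrite !mul0r addr0 add0r.
apply: eq_bigr => k _.
rewrite !(hornerM, hornerD, hornerN, hornerZ, hornerX, hornerC, horner_comp) /= /bump /= add1n.
have := wp k (ltn_ord k).
have -> : k.+1%:R + -1 = k%:R :> R by rewrite -natr1 addrK.
by move=> e; transitivity (v k * (c * (N%:R - k%:R)) * g.[k%:R]); [ring | rewrite -e; ring].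
Qed.

Context (p : nat -> {poly R}).
Hypothesis hp : orthonormal_polys N w p.

Let a := rec_a N w p.
Let b := rec_b N w p.

(** The matrix entry of A = c (N - x) S at row m and column n in the basis (p_n). *)
Definition shift_entry m n := dsum N w (tau * (p m * (p n \Po ('X + 1%:P)))).

Lemma shift_entry_adj m n :
  shift_entry m n = dsum N w (sigma * (p n * (p m \Po ('X + (-1)%:P)))).
Proof.
rewrite /shift_entry dsum_pearson; apply: eq_dsum => k _.
rewrite !(hornerM, hornerD, hornerN, hornerZ, hornerX, hornerC, horner_comp) subrK; ring.
Qed.

Lemma dsum_three_term n (q : {poly R}) : (n <= N)%N ->
  dsum N w ('X * p n * q) = a n.+1 * dsum N w (p n.+1 * q) +
    b n * dsum N w (p n * q) + a n * dsum N w (p n.-1 * q).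
Proof.
move=> nN; rewrite -!dsumZ -!dsumD; apply: eq_dsum => k kN.
rewrite !(hornerM, hornerD, hornerZ, hornerX) (three_term hp nN kN) -/a -/b; ring.
Qed.

Lemma size_poly_on n : (n <= N)%N -> size (p n) = n.+1.
Proof. by case: hp => + _ _; exact. Qed.

Lemma shift_size_coef h n : (n <= N)%N ->
  (size (p n \Po ('X + h%:P) - p n)%R <= n)%N /\
  (p n \Po ('X + h%:P) - p n)`_n.-1 = h * n%:R * (p n)`_n.
Proof. by move=> nN; apply: poly_shift_size_coef; rewrite size_poly_on. Qed.

(** Write S p_n = p_n + d with deg d < n. Then [tau * d] has degree at most n, so it contributes
    only for m = n, through its leading coefficient. *)
Lemma shift_entry_lower m n : (n <= m)%N -> (m <= N)%N ->
  shift_entry m n = c * (N%:R - n%:R) * (m == n)%:R - c * dsum N w (p m * ('X * p n)).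
Proof.
move=> nm mN; have nN := leq_trans nm mN.
have [sd cd] := shift_size_coef 1 nN; set d := _ - p n in sd cd.
have sd' : (size (tau * d)%R <= n.+1)%N.
  apply/leq_sizeP => j nj; rewrite /tau -scalerAl coefZ mulrBl mul_polyC coefB coefZ coefXM.
  have -> : d`_j = 0 by rewrite nth_default // (leq_trans sd (ltnW nj)).
  have -> : d`_j.-1 = 0 by rewrite nth_default // (leq_trans sd) //; lia.
  by rewrite mulr0; case: ifP; rewrite subrr mulr0.
have cd' : (tau * d)`_n = - (c * n%:R * (p n)`_n).
  rewrite /tau -scalerAl coefZ mulrBl mul_polyC coefB coefZ coefXM.
  have -> : d`_n = 0 by rewrite nth_default.
  by rewrite cd; case: eqP => [->|_]; ring.
rewrite /shift_entry.
have -> : tau * (p m * (p n \Po ('X + 1%:P))) =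
    c *: (N%:R *: (p m * p n) - p m * ('X * p n)) + p m * (tau * d).
  by rewrite /d /tau -!mul_polyC; ring.
rewrite dsumD dsumZ dsumB dsumZ (dsum_pp hp mN nN).
have -> : dsum N w (p m * (tau * d)) = - (c * n%:R) * (m == n)%:R.
  have [->|nm'] := eqVneq m n.
    rewrite (dsum_p_coef hp) // cd' -mulNr mulfK ?mulr1 //.
    by rewrite gt_eqF // (lead_gt0 hp).
  by rewrite (dsum_p_lower hp) ?mulr0 // (leq_trans sd') //; lia.
ring.
Qed.

Lemma shift_entry_diag n : (n <= N)%N -> shift_entry n n = c * (N%:R - n%:R - b n).
Proof. by move=> nN; rewrite shift_entry_lower // eqxx mulr1 /b rec_bE; ring. Qed.

Lemma shift_entry_sub n : (n < N)%N -> shift_entry n.+1 n = - (c * a n.+1).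
Proof.
move=> nN; rewrite shift_entry_lower //.
have -> : n.+1 == n = false by lia.
by rewrite mulr0 sub0r /a rec_aE.
Qed.

(** In the adjoint form p_n(x - 1) = p_n + d. The part with p_n gives b_(n+1) + b_n - alpha by the
    recurrence, and the leading coefficient of d gives -n. *)
Lemma shift_entry_super n : (n < N)%N ->
  shift_entry n n.+1 = a n.+1 * (b n.+1 + b n - n%:R - alpha).
Proof.
move=> nN; have nN' := ltnW nN; rewrite shift_entry_adj.
have [sd cd] := shift_size_coef (-1) nN'; set d := _ - p n in sd cd.
have -> : sigma * (p n.+1 * (p n \Po ('X + (-1)%:P))) =
    'X * p n.+1 * ('X * p n) - alpha *: (p n.+1 * ('X * p n)) +
    p n.+1 * ('X * ('X * d) - alpha *: ('X * d)).
  by rewrite /d /sigma -!mul_polyC; ring.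
have d0 : d`_n = 0 by rewrite nth_default.
rewrite dsumD dsumB dsumZ dsum_three_term // -!rec_aE // -/a.
have -> : dsum N w (p n.+1 * ('X * ('X * d) - alpha *: ('X * d))) = - n%:R * a n.+1.
  rewrite (dsum_p_coef hp) //; last first.
    apply/leq_sizeP => j nj; rewrite coefB coefZ !coefXM.
    have -> : d`_j.-2 = 0 by rewrite nth_default // (leq_trans sd) //; lia.
    have -> : d`_j.-1 = 0 by rewrite nth_default // (leq_trans sd) //; lia.
    by case: ifP; rewrite mulr0 subr0 //; case: ifP.
  rewrite /a (rec_a_ratio hp) // coefB coefZ !coefXM /= d0 mulr0 subr0 cd.
  by case: eqP => [->|_]; ring.
(* For n + 1 = N orthogonality says nothing about [p n.+2], but its factor a_(N+1) is zero. *)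
have -> : a n.+2 * dsum N w (p n.+2 * ('X * p n)) = 0.
  have [nN2|nN2] := ltnP n.+1 N.
    by rewrite (dsum_p_lower hp) ?mulr0 // -commr_polyX size_mulX
      -?size_poly_eq0 size_poly_on.
  have -> : n.+2 = N.+1 by lia.
  by rewrite /a rec_a_top mul0r.
by rewrite /= -/(dsum _ _ _) -rec_bE -/b; ring.
Qed.

(** In the adjoint form only the leading term of x^2 p_n(x - 1) survives. The ratio of leading
    coefficients of p_n and p_(n+2) is a product of two consecutive [rec_a_ratio]. *)
Lemma shift_entry_super2 n : (n.+1 < N)%N -> shift_entry n n.+2 = a n.+2 * a n.+1.
Proof.
move=> nN; have nN' : (n <= N)%N by lia.
rewrite shift_entry_adj.
have [sd _] := shift_size_coef (-1) nN'; set d := _ - p n in sd.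
set q := p n \Po _ in d sd *.
have sq j : (n < j)%N -> q`_j = 0.
  move=> nj; rewrite -[q](subrK (p n)) coefD.
  by rewrite !nth_default ?addr0 // ?size_poly_on // (leq_trans sd (ltnW nj)).
have cq : q`_n = (p n)`_n.
  by rewrite -[q](subrK (p n)) coefD nth_default // add0r.
have -> : sigma * (p n.+2 * q) = p n.+2 * ('X * ('X * q) - alpha *: ('X * q)).
  by rewrite /sigma -!mul_polyC; ring.
rewrite (dsum_p_coef hp) //; last first.
  apply/leq_sizeP => j nj; rewrite coefB coefZ !coefXM.
  rewrite (sq j.-2) ?(sq j.-1); [|lia|lia].
  by case: ifP; rewrite mulr0 subr0 //; case: ifP.
rewrite coefB coefZ !coefXM /= cq sq // mulr0 subr0.
rewrite /a !(rec_a_ratio hp) ?(ltnW nN) //.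
by rewrite [RHS]mulrC mulrA divfK // gt_eqF // (lead_gt0 hp) // ltnW.
Qed.

(* Matrix form of [S x - x S = S] for the shift operator [S]. *)
Lemma shift_entry_comm m n : (m <= N)%N -> (n <= N)%N ->
  a n.+1 * shift_entry m n.+1 + b n * shift_entry m n + a n * shift_entry m n.-1 =
  shift_entry m n + (a m.+1 * shift_entry m.+1 n + b m * shift_entry m n +
    a m * shift_entry m.-1 n).
Proof.
move=> mN nN; rewrite /shift_entry -!dsumZ -!dsumD; apply: eq_dsum => k kN.
rewrite /tau !(hornerM, hornerD, hornerN, hornerZ, hornerX, hornerC, horner_comp) /= -/a -/b.
have e1 := three_term hp mN kN.
(* The recurrence at k + 1 is available only for k < N; at k = N the factor N - k kills both
   sides. *)
have [kN'|kN'] := ltnP k N; last first.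
  by have -> : k = N by [lia]; ring.
have e2 := three_term hp nN kN'; rewrite -natr1 -/a -/b in e1 e2.
set t := c * _.
transitivity (t * ((p m).[k%:R] * ((k%:R + 1) * (p n).[k%:R + 1]))).
  by rewrite e2; ring.
transitivity (t * ((p m).[k%:R] * (p n).[k%:R + 1] +
  k%:R * (p m).[k%:R] * (p n).[k%:R + 1])); first by ring.
by rewrite e1; ring.
Qed.

(** The diagonal of the commutation relation, where the terms in b_n times the diagonal entry
    cancel. Out-of-range neighbours at n = 0 and n = N carry the factors a_0 = 0 and a_(N+1) = 0. *)
Lemma laguerre_freud1 n : (n <= N)%N ->
  a n.+1 ^+ 2 * (b n.+1 + b n - n%:R - alpha + c) -
  a n ^+ 2 * (b n + b n.-1 - n%:R + 1 - alpha + c) = c * (N%:R - n%:R - b n).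
Proof.
move=> nN; have := shift_entry_comm nN nN.
have e1 : a n.+1 * shift_entry n n.+1 = a n.+1 ^+ 2 * (b n.+1 + b n - n%:R - alpha).
  have [nN'|nN'] := ltnP n N; first by rewrite shift_entry_super //; ring.
  by have -> : n = N by [lia]; rewrite /a rec_a_top; ring.
have e2 : a n.+1 * shift_entry n.+1 n = - c * a n.+1 ^+ 2.
  have [nN'|nN'] := ltnP n N; first by rewrite shift_entry_sub //; ring.
  by have -> : n = N by [lia]; rewrite /a rec_a_top; ring.
have e3 : a n * shift_entry n n.-1 = - c * a n ^+ 2.
  case: n nN {e1 e2} => [|n] nN; first by rewrite /a rec_a_0; ring.
  by rewrite shift_entry_sub //=; ring.
have e4 : a n * shift_entry n.-1 n = a n ^+ 2 * (b n + b n.-1 - n%:R + 1 - alpha).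
  case: n nN {e1 e2 e3} => [|n] nN; first by rewrite /a rec_a_0; ring.
  by rewrite shift_entry_super //= -natr1; ring.
rewrite e1 e2 e3 e4 shift_entry_diag // => e.
by apply/eqP; rewrite -subr_eq0; move/eqP: e; rewrite -subr_eq0 => /eqP e;
  apply/eqP; rewrite -[RHS]e; ring.
Qed.

(** The entry (n, n + 1) of the commutation relation, divided by a_(n+1), which is positive. *)
Lemma laguerre_freud2 n : (n < N)%N ->
  a n.+2 ^+ 2 - a n ^+ 2 + (b n.+1 + b n - n%:R - alpha) * (b n.+1 - b n - 1) +
  c * (1 + b n.+1 - b n) = 0.
Proof.
move=> nN; have nN' := ltnW nN; have := shift_entry_comm nN' nN.
have e1 : a n.+2 * shift_entry n n.+2 = a n.+2 ^+ 2 * a n.+1.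
  have [nN2|nN2] := ltnP n.+1 N; first by rewrite shift_entry_super2 //; ring.
  by have -> : n.+2 = N.+1 by [lia]; rewrite /a rec_a_top; ring.
have e2 : a n * shift_entry n.-1 n.+1 = a n ^+ 2 * a n.+1.
  case: n nN {e1 nN'} => [|n] nN; first by rewrite /a rec_a_0; ring.
  by rewrite shift_entry_super2 //=; ring.
rewrite e1 e2 /= shift_entry_super // !shift_entry_diag // -natr1 => e.
have a0 : a n.+1 != 0 by rewrite gt_eqF // (rec_a_gt0 hp).
apply: (mulfI a0); move/eqP: e; rewrite -subr_eq0 => /eqP e.
by rewrite mulr0 -[RHS]e; ring.
Qed.

(** Both forms of the entry (0, 0) are compared; p_0 is constant, so the shift fixes it. This starts
    the induction for the determinant. *)
Lemma laguerre_freud0 : (0 < N)%N ->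
  a 1 ^+ 2 + b 0 ^+ 2 - alpha * b 0 + c * b 0 = c * N%:R.
Proof.
move=> N0; have := shift_entry_diag (leq0n N); rewrite shift_entry_adj.
have [sd _] := shift_size_coef (-1) (leq0n N).
move: sd; rewrite leqn0 size_poly_eq0 subr_eq0 => /eqP ->.
have -> : sigma * (p 0 * p 0) = 'X * p 0 * ('X * p 0) - alpha *: (p 0 * ('X * p 0)).
  by rewrite /sigma -!mul_polyC; ring.
rewrite dsumB dsumZ dsum_three_term // -rec_aE // -rec_bE -/a -/b /a rec_a_0.
by move=> e; rewrite -[c * N%:R](subrK (c * b 0)); move: e; rewrite -/a subr0 mulrBr => <-; ring.
Qed.

End GeneralizedKrawtchouk.

Lemma eq_lincomb (R : comNzRingType) (u v l1 r1 l2 r2 x y : R) :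
  l1 = r1 -> l2 = r2 -> x - y = u * (l1 - r1) + v * (l2 - r2) -> x = y.
Proof. by move=> -> -> e; apply: subr0_eq; rewrite e !subrr !mulr0 addr0. Qed.

(** * The determinant independent of n *)

Section LaxDeterminant.

Context (R : realType) (N : nat) (alpha c : R) (p : nat -> {poly R}).
Hypothesis halpha : alpha < 1.
Hypothesis hp : orthonormal_polys N (weight N alpha c) p.

Let a := rec_a N (weight N alpha c) p.
Let b := rec_b N (weight N alpha c) p.

(* With [xi = x - N] and [S] the shift [x -> x + 1],
   [c (N - x) S p_n = lax_m n xi p_n + a_n lax_f n xi p_(n-1)]. *)
Definition lax_m n (xi : R) : R := - (c * (xi + n%:R) + a n ^+ 2).
Definition lax_f n (xi : R) : R := xi + (b n + N%:R + 1 + c - n%:R - alpha).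

(* Determinant of the matrix of [c (N - x) S] acting on [(p_(n+1), p_n)]. *)
Definition lax_det n (xi : R) : R :=
  lax_m n.+1 xi * (lax_f n xi * (xi + N%:R - b n) + lax_m n xi) +
  a n.+1 ^+ 2 * (lax_f n.+1 xi * lax_f n xi).

(** Induction on n: the increment of the determinant is a combination of the two Laguerre-Freud
    equations with multipliers [lax_f n.+1 xi] and [- lax_m n.+1 xi]. In the base case
    [laguerre_freud0] takes the place of the second equation. *)
Lemma lax_detE n xi : (0 < N)%N -> (n <= N)%N ->
  lax_det n xi = - (c * xi * (xi + N%:R + 1) * (xi + N%:R + 1 - alpha)).
Proof.
move=> N0; have a0 : a 0 = 0 by exact: rec_a_0.
elim: n => [_|n IH nN].
  have := laguerre_freud1 halpha hp (leq0n N).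
  have := laguerre_freud0 halpha hp N0.
  rewrite -/a -/b a0 /= => e0 e1.
  apply: (eq_lincomb (u := lax_f 0 xi) (v := - lax_m 0 xi) e1 e0).
  by rewrite /lax_det /lax_m /lax_f a0; ring.
rewrite -(IH (ltnW nN)).
have := laguerre_freud1 halpha hp nN.
have := laguerre_freud2 halpha hp nN.
rewrite -/a -/b /= => e2 e1.
apply: (eq_lincomb (u := lax_f n.+1 xi) (v := - lax_m n.+1 xi) e1 e2).
by rewrite /lax_det /lax_f /lax_m -!natr1; ring.
Qed.

End LaxDeterminant.

(** * Terminating confluent hypergeometric series *)

Section Hypergeometric.

Context (R : realType).

Lemma pochhammerN n s :
  pochhammer (- n%:R : R) s = (-1) ^+ s * (n ^_ s)%:R.
Proof.
elim: s => [|s IH]; first by rewrite /pochhammer big_ord0 ffactn0 mulr1.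
rewrite pochhammerS IH ffactnSr natrM exprS.
have [sn|sn] := leqP s n; first by rewrite natrB //; ring.
by rewrite ffact_small //; ring.
Qed.

Lemma hyp1F1_terminating n (t c : R) : hyp1F1 (- n%:R) t (- c) =
  \sum_(s < n.+1) 'C(n, s)%:R * (c ^+ s / pochhammer t s).
Proof.
have termE s : pochhammer (- n%:R) s / (pochhammer t s * (s`!)%:R) * (- c) ^+ s =
    'C(n, s)%:R * (c ^+ s / pochhammer t s) :> R.
  have f0 : (s`!)%:R != 0 :> R by rewrite pnatr_eq0 -lt0n fact_gt0.
  rewrite pochhammerN -bin_ffact natrM invfM (exprNn c).
  have s1 : (-1) ^+ s * (-1) ^+ s = 1 :> R by rewrite -exprMn mulrNN mulr1 expr1n.
  transitivity ((-1) ^+ s * (-1) ^+ s * ((s`!)%:R / (s`!)%:R) *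
    ('C(n, s)%:R * (c ^+ s / pochhammer t s)) : R); first by ring.
  by rewrite s1 divff // !mul1r.
(* The partial sums are constant once they include s = n, since the binomial vanishes for s > n. *)
apply: lim_near_cst => //; near=> m.
rewrite /series /= (big_cat_nat (n := n.+1)) //=; last by near: m; exact: nbhs_infty_ge.
rewrite big_mkord [X in _ + X]big_nat_cond [X in _ + X]big1 ?addr0.
  by apply: eq_bigr => s _.
by move=> s; rewrite andbT => /andP[ns _]; rewrite termE bin_small ?mul0r.
Unshelve. all: by end_near. Qed.

End Hypergeometric.

(** * The initial value b_0 as a ratio of moments *)

Section FirstCoefficient.

Context (R : realType) (N : nat) (alpha c : R) (p : nat -> {poly R}).
Hypothesis halpha : alpha < 1.
Hypothesis hp : orthonormal_polys N (weight N alpha c) p.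

Let w := weight N alpha c.

Lemma weight_sum : \sum_(k < N.+1) w k = hyp1F1 (- N%:R) (1 - alpha) (- c).
Proof. by rewrite hyp1F1_terminating. Qed.

(** Absorb k by k C(N, k) = N C(N - 1, k - 1), and split off the first factor of the Pochhammer
    symbol, which raises its base to 2 - alpha. *)
Lemma weight_first_moment : (0 < N)%N -> \sum_(k < N.+1) k%:R * w k =
  N%:R * (c / (1 - alpha)) * hyp1F1 (- N%:R + 1) (2 - alpha) (- c).
Proof.
case: N @w => // n w' _.
have -> : - n.+1%:R + 1 = - n%:R :> R by rewrite -natr1; ring.
rewrite hyp1F1_terminating big_ord_recl [X in X + _]mul0r add0r big_distrr.
apply: eq_bigr => k _; rewrite /= /bump /= add1n /w' /weight pochhammerS_l.
have -> : 1 - alpha + 1 = 2 - alpha by ring.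
rewrite exprS invfM.
have e := congr1 (fun i : nat => i%:R : R) (mul_bin_diag n.+1 k).
rewrite /= !natrM in e.
transitivity (k.+1%:R * 'C(n.+1, k.+1)%:R *
  (c * c ^+ k * ((1 - alpha)^-1 * (pochhammer (2 - alpha) k)^-1))); first by ring.
by rewrite -e; ring.
Qed.

(** Since p_0 is a constant g, b_0 is the first moment times g^2, and normalization makes g^2 the
    inverse of the total mass, which is therefore nonzero. *)
Lemma rec_b0 : (0 < N)%N -> rec_b N w p 0 =
  N%:R * (c / (1 - alpha)) * (hyp1F1 (- N%:R + 1) (2 - alpha) (- c) /
    hyp1F1 (- N%:R) (1 - alpha) (- c)).
Proof.
move=> N0; have [hs _ ho] := hp.
have /size1_polyC p0 : (size (p 0) <= 1)%N by rewrite hs.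
set g := (p 0)`_0 in p0.
have norm : g ^+ 2 * hyp1F1 (- N%:R) (1 - alpha) (- c) = 1.
  transitivity ((0%N == 0%N)%:R : R) => //; rewrite -(ho 0 0) //.
  rewrite -weight_sum big_distrr; apply: eq_bigr => k _.
  by rewrite p0 hornerC.
have h0 : hyp1F1 (- N%:R) (1 - alpha) (- c) != 0.
  by apply/eqP => h; move: norm; rewrite h mulr0 => /eqP; rewrite eq_sym oner_eq0.
have -> : rec_b N w p 0 = g ^+ 2 * \sum_(k < N.+1) k%:R * w k.
  rewrite big_distrr; apply: eq_bigr => k _.
  by rewrite p0 hornerC /=; ring.
rewrite weight_first_moment //; apply: (mulIf h0).
rewrite -[RHS]mulrA divfK //.
move: norm; set H := hyp1F1 _ (1 - alpha) _; set G := hyp1F1 _ _ _ => norm.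
by rewrite -[RHS]mul1r -norm; ring.
Qed.

End FirstCoefficient.

(** * The discrete system and its initial conditions *)

Theorem theorem1p1 (R : realType) (N : nat) (alpha c : R)
    (p : nat -> {poly R}) (x y : nat -> R)
    (hN : (1 <= N)%N) (halpha : alpha < 1) (hc : 0 < c)
    (hp : orthonormal_polys N (weight N alpha c) p)
    (hx : forall n, (n <= N.+1)%N ->
       x n = 1 / N%:R * (rec_a N (weight N alpha c) p n ^+ 2 / c + n%:R))
    (hy : forall n, (n <= N)%N ->
       y n = - ((rec_b N (weight N alpha c) p n + N%:R + 1 + c - n%:R - alpha)
                / N%:R)) :
  [/\ forall n, (n <= N)%N ->
        (x n + y n) * (x n.+1 + y n) =
        - ((y n * (N%:R + 1 + N%:R * y n) * (N%:R + 1 - alpha + N%:R * y n))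
           / (c * N%:R)),
      forall n, (1 <= n <= N)%N ->
        (x n + y n) * (x n + y n.-1) =
        (x n * (- N%:R - 1 + N%:R * x n) * (alpha - N%:R - 1 + N%:R * x n))
        / (N%:R * (N%:R * x n - n%:R)),
      x 0%N = 0
    & y 0%N =
        - ((N%:R + 1 + c - alpha) / N%:R)
        - c / (1 - alpha)
          * (hyp1F1 (- N%:R + 1) (2 - alpha) (- c)
             / hyp1F1 (- N%:R) (1 - alpha) (- c))].
Proof.
set w := weight N alpha c in hp hx hy *.
set a := rec_a N w p in hx *; set b := rec_b N w p in hy *.
have N0 : N%:R != 0 :> R by rewrite pnatr_eq0 -lt0n.
have c0 : c != 0 by rewrite gt_eqF.
have det n xi (nN : (n <= N)%N) := lax_detE halpha hp xi hN nN.
have mE n xi : (n <= N.+1)%N -> lax_m N alpha c p n xi = - (c * (xi + N%:R * x n)).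
  by move=> nN; rewrite hx // /lax_m -/a; field; rewrite c0 N0.
have fE n xi : (n <= N)%N -> lax_f N alpha c p n xi = xi - N%:R * y n.
  by move=> nN; rewrite hy // /lax_f -/b; field.
split.
(* At xi = N y_n the entry [lax_f n] vanishes and the determinant reduces to the product of
   [lax_m n.+1] and [lax_m n]. *)
- move=> n nN; have := det n (N%:R * y n) nN.
  rewrite /lax_det !mE ?ltnS ?leqW // (fE n) // subrr mul0r add0r mulr0 mulr0 addr0 => e.
  have cN : (c * N%:R) ^+ 2 != 0 by rewrite expf_neq0 // mulf_neq0.
  apply: (mulfI cN).
  transitivity (- (c * (N%:R * y n + N%:R * x n.+1)) * - (c * (N%:R * y n + N%:R * x n)));
    first by ring.
  by rewrite e; field; rewrite c0 N0.
(* With the index written n + 1, the determinant at n is evaluated at the zero of [lax_m n.+1],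
   leaving the product of two values of [lax_f]. *)
- case=> // n /andP[_ nN]; have := det n (- (N%:R * x n.+1)) (ltnW nN).
  (* The denominator of the second equation is a_(n+1)^2 / c, hence nonzero. *)
  have aE : N%:R * x n.+1 - n.+1%:R = a n.+1 ^+ 2 / c.
    by rewrite hx ?leqW //; field; rewrite c0 N0.
  have a0 : a n.+1 != 0 by rewrite gt_eqF // (rec_a_gt0 hp).
  have m0 : lax_m N alpha c p n.+1 (- (N%:R * x n.+1)) = 0.
    by rewrite mE ?leqW // addNr mulr0 oppr0.
  rewrite /lax_det m0 mul0r add0r (fE _ _ nN) (fE _ _ (ltnW nN)) -/a => e.
  rewrite aE; apply: (mulfI (expf_neq0 2 a0)); apply: (mulfI N0); apply: (mulfI N0).
  transitivity (a n.+1 ^+ 2 * ((- (N%:R * x n.+1) - N%:R * y n.+1) *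
    (- (N%:R * x n.+1) - N%:R * y n))); first by rewrite /=; ring.
  by rewrite e; field; rewrite c0 N0 a0.
- by rewrite hx // /a rec_a_0 expr0n /= mul0r addr0 mulr0.
rewrite hy // /b rec_b0 //.
set H := hyp1F1 _ _ _ / _.
have a1 : 1 - alpha != 0 by rewrite subr_eq0 eq_sym lt_eqF.
by field; rewrite N0 a1.
Qed.
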